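(* Let $G$ and $H$ be finite connected graphs with diameters $d_G$ and $d_H$, respectively, such that $W(G)\geq\max\{E_1(G),E_2(G)\}$ and $W(H)\geq\max\{E_1(H),E_2(H)\}$. If ${\rm avt}(G)>4d_G^2d_H$ and ${\rm avt}(H)>4d_H^2d_G$, then $W(G\,\square\,H)>E_2(G\,\square\,H)$.
   Context: $G\,\square\,H$ is the Cartesian product: vertex set $V(G)\times V(H)$, with $(g,h)$ adjacent to $(g',h')$ iff either $gg'\in E(G)$ and $h=h'$, or $g=g'$ and $hh'\in E(H)$. For a connected graph $X$: $\varepsilon_X(v)=\max_u d_X(v,u)$, $E_1(X)=\sum_v\varepsilon_X(v)^2$, $E_2(X)=\sum_{uv\in E(X)}\varepsilon_X(u)\varepsilon_X(v)$, $W(X)=\sum_{\{u,v\}\subseteq V(X)}d_X(u,v)$ (Wiener index), and ${\rm avt}(X)=\frac{2W(X)}{n(X)}$ is the average transmission, where $n(X)$ is the order of $X$. *)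

(* Defs.v *)
From HB Require Import structures.
From mathcomp Require Import all_boot all_order all_algebra.
Set Implicit Arguments.
Unset Strict Implicit.
Unset Printing Implicit Defensive.

Record sgraph := SGraph {
  vertex :> finType;
  edge : rel vertex;
  edge_sym : symmetric edge;
  edge_irrefl : irreflexive edge }.

Definition connected (X : sgraph) : Prop :=
  0 < #|X| /\ forall u v : X, connect (@edge X) u v.

Section CartesianProduct.
Variables G H : sgraph.

Definition cart_edge : rel (G * H) := fun x y =>
  (edge x.1 y.1 && (x.2 == y.2)) || ((x.1 == y.1) && edge x.2 y.2).

Lemma cart_edge_sym : symmetric cart_edge.
Proof.
move=> x y; rewrite /cart_edge (edge_sym x.1) (edge_sym x.2).
by rewrite (eq_sym x.1) (eq_sym x.2).
Qed.

Lemma cart_edge_irrefl : irreflexive cart_edge.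
Proof. by move=> x; rewrite /cart_edge !edge_irrefl andbF. Qed.

Definition cart_prod : sgraph :=
  @SGraph (G * H)%type cart_edge cart_edge_sym cart_edge_irrefl.

End CartesianProduct.

Section Invariants.
Variable X : sgraph.

Definition walk (n : nat) (u v : X) : bool :=
  [exists p : n.-tuple X, path (@edge X) u p && (last u p == v)].

(* A shortest walk repeats no vertex, so its length is below #|X|; the default
   value #|X| is taken only when u and v lie in different components. *)
Definition dist (u v : X) : nat :=
  \big[minn/#|X|]_(n < #|X| | walk n u v) (n : nat).

Definition ecc (v : X) : nat := \max_(u : X) dist v u.

Definition diam : nat := \max_(u : X) \max_(v : X) dist u v.

(* Holds for exactly one ordering of each pair of distinct vertices; it is used
   to sum over unordered pairs {u, v}. *)
Definition before (u v : X) : bool := enum_rank u < enum_rank v.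

Definition E1 : nat := \sum_(v : X) ecc v ^ 2.

Definition E2 : nat :=
  \sum_(u : X) \sum_(v : X | before u v && edge u v) ecc u * ecc v.

Definition W : nat := \sum_(u : X) \sum_(v : X | before u v) dist u v.

Definition avt : rat := ((2 * W)%N%:R / #|X|%:R)%R.

End Invariants.

(* Main.v *)
(** Distances and hence eccentricities in G □ H are (at most, for the latter)
    sums of those in the factors.  With n = |G| and m = |H| this gives
    W(G □ H) = m^2 W(G) + n^2 W(H), while expanding
    (a + x)(b + x) = ab + (a + b)x + x^2 <= ab + 2 d_G d_H + x^2 over the edges of
    each layer, of which a copy of G has at most n(n-1)/2, gives
    2 E_2(G □ H) <= 2m E_2(G) + n(n-1)(2m d_G d_H + E_1(H)) + (symmetric term).
    The hypotheses on E_1 and E_2 reduce the claim to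
    2 n d_G d_H < W(G) and its mirror image, which follow from those on avt. *)
Require Import Defs.
From HB Require Import structures.
From mathcomp Require Import all_boot all_order all_algebra.
From mathcomp Require Import zify.

Set Implicit Arguments.
Unset Strict Implicit.
Unset Printing Implicit Defensive.

(** * Minima with a default value *)

Lemma bigminn_le_idx (I : Type) (r : seq I) (P : pred I) (F : I -> nat) d :
  \big[minn/d]_(i <- r | P i) F i <= d.
Proof.
apply: (big_rec (fun x => x <= d)) => // i x _ le_xd.
by rewrite geq_min le_xd orbT.
Qed.

Lemma bigminn_le (I : eqType) (r : seq I) (P : pred I) (F : I -> nat) d j :
  j \in r -> P j -> \big[minn/d]_(i <- r | P i) F i <= F j.
Proof.
move=> + Pj; elim: r => // i r IH; rewrite inE big_cons => /predU1P[<-|/IH le_r].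
  by rewrite Pj geq_minl.
by case: ifP => // _; rewrite geq_min le_r orbT.
Qed.

(** * Walks, distances and sums over pairs in a single graph *)

Section Distances.
Variable X : sgraph.
Implicit Types u v w : X.

Lemma walkP n u v :
  reflect (exists p, [/\ size p = n, path (@edge X) u p & last u p = v])
          (walk n u v).
Proof.
apply: (iffP existsP) => [[p /andP[pth /eqP lst]]|[p [sz pth lst]]].
  by exists p; rewrite size_tuple.
by exists (Tuple (introT eqP sz)); rewrite /= pth lst eqxx.
Qed.

Lemma walk_cat n k u v w : walk n u v -> walk k v w -> walk (n + k) u w.
Proof.
move=> /walkP[p [<- pp lp]] /walkP[q [<- pq lq]]; apply/walkP; exists (p ++ q).
by rewrite size_cat cat_path last_cat pp lp pq lq.
Qed.

Lemma walk_sym n u v : walk n u v -> walk n v u.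
Proof.
move=> /walkP[p [<- pp <-]]; apply/walkP; exists (rev (belast u p)).
rewrite size_rev size_belast rev_path; split=> //.
  by rewrite (eq_path (e' := @edge X)) // => x y; rewrite edge_sym.
by case: p {pp} => //= x p; rewrite rev_cons last_rcons.
Qed.

Lemma dist_le_walk n u v : walk n u v -> dist u v <= n.
Proof.
(* A walk too long to be an index of the minimum is covered by the default, as [#|X| <= n]. *)
move=> wn; case: (ltnP n #|X|) => [lt_n|]; last exact/leq_trans/bigminn_le_idx.
by apply: (@bigminn_le _ _ _ (@nat_of_ord _) _ (Ordinal lt_n));
   rewrite ?mem_index_enum.
Qed.

(** Shortening a path makes its vertices distinct, so some walk has length below [#|X|]; the minimum
    is then below its default and hence attained. *)
Lemma walk_dist u v : connect (@edge X) u v -> walk (dist u v) u v.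
Proof.
case/connectP => p0 /shortenP[p pp up _] lst.
have wp : walk (size p) u v by apply/walkP; exists p.
have lt_p : size p < #|X|.
  by rewrite -[(size p).+1]/(size (u :: p)) -(card_uniqP up) max_card.
have: dist u v < #|X| by exact: leq_ltn_trans (dist_le_walk wp) lt_p.
suff [->|//] : dist u v = #|X| \/ walk (dist u v) u v by rewrite ltnn.
rewrite {1 2}/dist; apply: (big_ind (fun x => x = #|X| \/ walk x u v)) => //.
- by left.
- by move=> x y Hx Hy; rewrite /minn; case: ifP.
- by move=> i; right.
Qed.

Lemma distxx u : dist u u = 0.
Proof.
by apply/eqP; rewrite -leqn0; apply: dist_le_walk; apply/walkP; exists [::].
Qed.

Lemma dist_sym u v : dist u v = dist v u.
Proof.
apply: eq_bigl => i; apply/idP/idP; exact: walk_sym.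
Qed.

Lemma dist_le_ecc u v : dist u v <= ecc u.
Proof. exact: (leq_bigmax (F := fun w => dist u w)). Qed.

Lemma ecc_le_diam u : ecc u <= diam X.
Proof. exact: (leq_bigmax (F := @ecc X)). Qed.

Lemma sum_unordered (f : X -> X -> nat) :
    (forall u v, f u v = f v u) -> (forall u, f u u = 0) ->
  \sum_(u : X) \sum_(v : X) f u v =
  2 * \sum_(u : X) \sum_(v : X | before u v) f u v.
Proof.
move=> f_sym f0; rewrite mul2n -addnn.
rewrite [X in _ = _ + X](exchange_big_dep xpredT) //= -big_split /=.
apply: eq_bigr => u _; rewrite (bigID (before u)) /=; congr (_ + _).
(* The pairs failing [before u v] are those with [before v u] and the diagonal, where [f]
   vanishes. *)
rewrite (bigID (fun v : X => before v u)) /= [X in _ + X]big1 ?addn0 => [|v].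
  apply: eq_big => [v|v _]; last exact: f_sym.
  by rewrite /before -leqNgt; case: ltngtP.
rewrite /before -!leqNgt -eqn_leq => /eqP/ord_inj/enum_rank_inj->; exact: f0.
Qed.

Lemma double_W : 2 * W X = \sum_(u : X) \sum_(v : X) dist u v.
Proof. by rewrite (sum_unordered dist_sym distxx). Qed.

Lemma double_E2 :
  2 * E2 X = \sum_(u : X) \sum_(v : X) edge u v * (ecc u * ecc v).
Proof.
rewrite sum_unordered => [|u v|u]; last by rewrite edge_irrefl.
  congr (2 * _); apply: eq_bigr => u _; rewrite big_mkcondr /=.
  by apply: eq_bigr => v _; case: edge; rewrite ?mul1n.
by rewrite edge_sym [ecc u * _]mulnC.
Qed.

(** Irreflexivity removes the diagonal. The saving of [#|X|] over the square leaves exactly the room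
    that the [E2] terms fill in the final comparison. *)
Lemma sum_edge_le : \sum_(u : X) \sum_(v : X) edge u v <= #|X| * #|X|.-1.
Proof.
rewrite -sum_nat_const; apply: leq_sum => u _.
rewrite (bigD1 u) //= edge_irrefl add0n.
apply: (leq_trans (n := \sum_(v | v != u) 1)).
  by apply: leq_sum => v _; case: edge.
by rewrite sum1_card -subn1 (cardC1 u) subn1.
Qed.

Lemma avt_gt_W k : connected X -> (k%:R < avt X)%R -> k * #|X| < 2 * W X.
Proof.
case=> X_gt0 _; rewrite /avt Num.Theory.ltr_pdivlMr ?Num.Theory.ltr0n //.
by rewrite -GRing.Theory.natrM Num.Theory.ltr_nat.
Qed.

End Distances.

(** * Walks and distances in the Cartesian product *)

Section Product.
Variables G H : sgraph.

Lemma walk_fst_prod n (g g' : G) (h : H) :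
  walk n g g' -> walk (X := cart_prod G H) n (g, h) (g', h).
Proof.
move=> /walkP[p [<- pp <-]]; apply/walkP; exists [seq (x, h) | x <- p].
rewrite size_map; split=> //; last by rewrite (last_map (fun x => (x, h))).
elim: p g {g'} pp => //= x p IH g /andP[e_gx /IH ->].
by rewrite /cart_edge /= e_gx eqxx.
Qed.

Lemma walk_snd_prod n (g : G) (h h' : H) :
  walk n h h' -> walk (X := cart_prod G H) n (g, h) (g, h').
Proof.
move=> /walkP[p [<- pp <-]]; apply/walkP; exists [seq (g, x) | x <- p].
rewrite size_map; split=> //; last by rewrite (last_map (fun x => (g, x))).
elim: p h {h'} pp => //= x p IH h /andP[e_hx /IH ->].
by rewrite /cart_edge /= e_hx eqxx orbT.
Qed.

(** Each edge of the product moves exactly one coordinate, so each step is charged to one factor. *)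
Lemma walk_prod_split n (x y : cart_prod G H) : walk n x y ->
  exists a b, [/\ a + b = n, walk a x.1 y.1 & walk b x.2 y.2].
Proof.
case/walkP => p [<- + <-] {y n}; elim: p x => [|z p IH] x /=.
  by move=> _; exists 0, 0; split=> //; apply/walkP; exists [::].
case/andP => e_xz /IH[a [b [<- wa wb]]].
have w1 (X : sgraph) (u v : X) : edge u v -> walk 1 u v.
  by move=> e_uv; apply/walkP; exists [:: v]; rewrite /= e_uv.
case/orP: e_xz => /andP[].
  by move=> /w1 w /eqP->; exists a.+1, b; split=> //; apply: walk_cat w wa.
move=> /eqP-> /w1 w; exists a, b.+1; split=> //; last exact: walk_cat w wb.
by rewrite addnS.
Qed.

Hypotheses (cG : connected G) (cH : connected H).

(** Lifting shortest walks and joining them at [(g', h)] gives the upper bound and also connects the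
    endpoints; splitting a shortest product walk gives the lower bound. *)
Lemma dist_prod (x y : cart_prod G H) : dist x y = dist x.1 y.1 + dist x.2 y.2.
Proof.
case: x y => [g h] [g' h'] /=.
have w : walk (X := cart_prod G H) (dist g g' + dist h h') (g, h) (g', h').
  have wg := walk_dist (proj2 cG g g'); have wh := walk_dist (proj2 cH h h').
  exact: walk_cat (walk_fst_prod h wg) (walk_snd_prod g' wh).
apply/eqP; rewrite eqn_leq dist_le_walk //=.
have c : connect (@edge (cart_prod G H)) (g, h) (g', h').
  by case/walkP: w => p [_ pp <-]; apply/connectP; exists p.
have [a [b [<- wa wb]]] := walk_prod_split (walk_dist c).
by apply: leq_add; apply: dist_le_walk.
Qed.

Lemma ecc_prod_le (x : cart_prod G H) : ecc x <= ecc x.1 + ecc x.2.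
Proof.
by apply/bigmax_leqP => y _; rewrite dist_prod leq_add ?dist_le_ecc.
Qed.

Lemma sum_prod (F : cart_prod G H -> nat) :
  \sum_(x : cart_prod G H) F x = \sum_(g : G) \sum_(h : H) F (g, h).
Proof. by rewrite pair_bigA; apply: eq_bigr => -[]. Qed.

Lemma W_prod : W (cart_prod G H) = #|H| ^ 2 * W G + #|G| ^ 2 * W H.
Proof.
(* Doubling passes to ordered pairs, where each distance in one factor recurs for every pair of
   coordinates in the other. *)
suff: 2 * W (cart_prod G H) = #|H| ^ 2 * (2 * W G) + #|G| ^ 2 * (2 * W H) by lia.
rewrite !double_W sum_prod.
under eq_bigr => g _.
  under eq_bigr => h _.
    rewrite sum_prod.
    under eq_bigr => g' _.
      under eq_bigr => h' _ do rewrite dist_prod /=.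
      rewrite big_split /= sum_nat_const; over.
    rewrite big_split /= sum_nat_const -big_distrr /=; over.
  rewrite big_split /= sum_nat_const -big_distrr /=; over.
rewrite big_split /= sum_nat_const -!big_distrr /=.
by rewrite -!mulnn !mulnA.
Qed.

End Product.

(** * Upper bound on [E2] of the product, and the final comparison *)

Lemma sum_edges_layers_le (G H : sgraph) :
  \sum_(g : G) \sum_(g' : G) edge g g' *
     \sum_(h : H) (ecc g + ecc h) * (ecc g' + ecc h) <=
  #|H| * (2 * E2 G)
    + #|G| * #|G|.-1 * (#|H| * (2 * diam G * diam H) + E1 H).
Proof.
(* [c] bounds, uniformly in the edge, what all copies of one edge of [G] contribute beyond
   [#|H| * (ecc g * ecc g')]. *)
set c := #|H| * (2 * diam G * diam H) + E1 H.
have layer (g g' : G) : \sum_(h : H) (ecc g + ecc h) * (ecc g' + ecc h) <=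
    #|H| * (ecc g * ecc g') + c.
  rewrite /c /E1 addnA -mulnDr -sum_nat_const -big_split /=.
  apply: leq_sum => h _.
  have := ecc_le_diam g; have := ecc_le_diam g'; have := ecc_le_diam h.
  move: (ecc g) (ecc g') (ecc h) (diam G) (diam H) => a b x dG dH.
  move=> le_x le_b le_a; rewrite -mulnn.
  (* The cross terms [a * x] and [b * x] are each at most [dG * dH]. *)
  have := leq_mul le_a le_x; have := leq_mul le_b le_x; lia.
apply: (leq_trans (n := \sum_(g : G) \sum_(g' : G)
   (#|H| * (edge g g' * (ecc g * ecc g')) + edge g g' * c))).
  apply: leq_sum => g _; apply: leq_sum => g' _.
  by case: edge; rewrite ?mul1n ?mul0n ?muln0.
rewrite double_E2; under eq_bigr do rewrite big_split /= -big_distrr -big_distrl /=.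
by rewrite big_split /= -big_distrr -big_distrl /= leq_add2l leq_mul2r sum_edge_le orbT.
Qed.

Lemma E2_prod_le (G H : sgraph) : connected G -> connected H ->
  2 * E2 (cart_prod G H) <=
    (#|H| * (2 * E2 G)
      + #|G| * #|G|.-1 * (#|H| * (2 * diam G * diam H) + E1 H))
  + (#|G| * (2 * E2 H)
      + #|H| * #|H|.-1 * (#|G| * (2 * diam H * diam G) + E1 G)).
Proof.
move=> cG cH; apply: leq_trans (leq_add (sum_edges_layers_le G H)
                                        (sum_edges_layers_le H G)).
(* [A] and [B] weight the edges inside copies of [G] and of [H]; the equality test collapses one
   inner sum to a single layer. *)
pose A (g : G) (h : H) (g' : G) (h' : H) :=
  edge g g' * (h == h') * ((ecc g + ecc h) * (ecc g' + ecc h')).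
pose B (g : G) (h : H) (g' : G) (h' : H) :=
  (g == g') * edge h h' * ((ecc g + ecc h) * (ecc g' + ecc h')).
have sumA : \sum_g \sum_h \sum_g' \sum_h' A g h g' h' =
    \sum_(g : G) \sum_(g' : G) edge g g' * \sum_(h : H) (ecc g + ecc h) * (ecc g' + ecc h).
  apply: eq_bigr => g _; rewrite exchange_big; apply: eq_bigr => g' _ /=.
  rewrite big_distrr; apply: eq_bigr => h _ /=.
  rewrite (bigD1 h) //= /A eqxx muln1 big1 ?addn0 // => h' ne_h.
  by rewrite eq_sym (negPf ne_h) muln0.
have sumB : \sum_g \sum_h \sum_g' \sum_h' B g h g' h' =
    \sum_(h : H) \sum_(h' : H) edge h h' * \sum_(g : G) (ecc h + ecc g) * (ecc h' + ecc g).
  rewrite exchange_big; apply: eq_bigr => h _.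
  under [RHS]eq_bigr do rewrite big_distrr.
  rewrite [RHS]exchange_big; apply: eq_bigr => g _ /=.
  rewrite (bigD1 g) //= [X in _ + X]big1 ?addn0 => [|g' ne_g].
    by apply: eq_bigr => h' _; rewrite /B eqxx mul1n ![ecc g + _]addnC.
  by rewrite big1 // => h' _; rewrite /B eq_sym (negPf ne_g).
rewrite -sumA -sumB double_E2 sum_prod -big_split /=.
apply: leq_sum => g _; rewrite -big_split; apply: leq_sum => h _ /=.
rewrite sum_prod -big_split; apply: leq_sum => g' _ /=.
rewrite -big_split; apply: leq_sum => h' _ /=; rewrite /A /B -mulnDl.
apply: leq_mul; last by apply: leq_mul; apply: ecc_prod_le.
(* The indicator of a disjunction is at most the sum of the two indicators. *)
rewrite /cart_edge /=.
by case: (edge g g'); case: (h == h'); case: (g == g'); case: (edge h h').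
Qed.

Theorem theorem5p4 (G H : sgraph)
    (cG : connected G) (cH : connected H)
    (hG : maxn (E1 G) (E2 G) <= W G)
    (hH : maxn (E1 H) (E2 H) <= W H)
    (aG : ((4 * diam G ^ 2 * diam H)%N%:R < avt G)%R)
    (aH : ((4 * diam H ^ 2 * diam G)%N%:R < avt H)%R) :
  E2 (cart_prod G H) < W (cart_prod G H).
Proof.
(* Two vertices in each factor make [#|X| * #|X|.-1] positive, which keeps the later inequalities
   strict. *)
have gt1 (X : sgraph) : 0 < W X -> 1 < #|X|.
  rewrite [1 < _]ltnNge; apply: contraTN => le1; rewrite -eqn0Ngt -(eqn_pmul2l (m := 2)) //.
  rewrite double_W big1 // => u _; rewrite big1 // => v _.
  by rewrite (fintype_le1P le1 u v) distxx.
have ltW (X : sgraph) a b : connected X ->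
    ((4 * a ^ 2 * b)%N%:R < avt X)%R -> 2 * #|X| * (a * b) < W X.
  move=> cX /(avt_gt_W cX) lt_W.
  (* Since [a <= a ^ 2] in the naturals, the bound [2 * #|X| * (a ^ 2 * b) < W X] passes to [a * b],
     the product in the cross terms. *)
  have : a * b <= a ^ 2 * b by rewrite leq_mul2r -mulnn; case: a {lt_W} => *; nia.
  nia.
have {aG} ltG := ltW _ _ _ cG aG; have {aH} ltH := ltW _ _ _ cH aH.
have nG : 1 < #|G| by apply: gt1; apply: leq_ltn_trans ltG.
have nH : 1 < #|H| by apply: gt1; apply: leq_ltn_trans ltH.
move: hG hH; rewrite !geq_max => /andP[E1G E2G] /andP[E1H E2H].
rewrite -(ltn_pmul2l (m := 2)) //; apply: leq_ltn_trans (E2_prod_le cG cH) _.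
rewrite (W_prod cG cH) -!mulnn.
move: ltG ltH nG nH E1G E2G E1H E2H.
move: #|G| #|H| (W G) (W H) (E1 G) (E2 G) (E1 H) (E2 H) (diam G) (diam H).
case=> [|n] // [|m] // wG wH e1G e2G e1H e2H a b /= ltG ltH n_gt0 m_gt0.
move=> E1G E2G E1H E2H.
(* This adds [2 * n.+1 * (a * b) < wG] and [e1G <= wG]. *)
have gainG : m.+1 * m * (2 * n.+1 * (a * b) + e1G) < m.+1 * m * (2 * wG).
  by rewrite ltn_pmul2l ?muln_gt0 //; lia.
have gainH : n.+1 * n * (2 * m.+1 * (b * a) + e1H) < n.+1 * n * (2 * wH).
  by rewrite ltn_pmul2l ?muln_gt0 //; lia.
(* With [M = m.+1], the two contributions for [G] add up exactly: [2 * M * wG + M * m * (2 * wG) = 2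
   * M ^ 2 * wG]; likewise for [H]. *)
have := leq_mul (leqnn m.+1) E2G; have := leq_mul (leqnn n.+1) E2H.
nia.
Qed.
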